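(* Let $\mathcal{A}\in T_{m,n}$ be strictly semi-positive and let $\mathbf{q}\in\mathbb{R}^n$. If $\mathbf{x}$ is a solution of the tensor complementarity problem TCP$(\mathcal{A},\mathbf{q})$, then $$\|\mathbf{x}\|_\infty^{m-1}\le\frac{\|(-\mathbf{q})_+\|_\infty}{\beta(\mathcal{A})}.$$
   Context: $T_{m,n}$ denotes the set of all real $m$th order $n$-dimensional tensors $\mathcal{A}=(a_{i_1\cdots i_m})$, $1\le i_1,\dots,i_m\le n$, with order $m\ge 2$ (no symmetry is assumed). For $\mathbf{x}\in\mathbb{R}^n$, $\mathcal{A}\mathbf{x}^{m-1}\in\mathbb{R}^n$ is the vector with components $(\mathcal{A}\mathbf{x}^{m-1})_i=\sum_{i_2,\dots,i_m=1}^n a_{ii_2\cdots i_m}x_{i_2}\cdots x_{i_m}$. For vectors, $\mathbf{x}\ge\mathbf{0}$ means $x_i\ge 0$ for all $i$. $\mathcal{A}$ is strictly semi-positive iff for each $\mathbf{x}\ge\mathbf{0}$ with $\mathbf{x}\ne\mathbf{0}$ there is an index $k\in\{1,\dots,n\}$ with $x_k>0$ and $(\mathcal{A}\mathbf{x}^{m-1})_k>0$. A solution of TCP$(\mathcal{A},\mathbf{q})$ is a vector $\mathbf{x}\in\mathbb{R}^n$ with $\mathbf{x}\ge\mathbf{0}$, $\mathbf{q}+\mathcal{A}\mathbf{x}^{m-1}\ge\mathbf{0}$ and $\mathbf{x}^\top(\mathbf{q}+\mathcal{A}\mathbf{x}^{m-1})=0$. $\|\mathbf{x}\|_\infty=\max_{1\le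 i\le n}|x_i|$; $\mathbf{x}_+=(\max\{x_1,0\},\dots,\max\{x_n,0\})^\top$; and for strictly semi-positive $\mathcal{A}$ $$\beta(\mathcal{A}):=\min_{\mathbf{x}\ge\mathbf{0},\ \|\mathbf{x}\|_\infty=1}\ \max_{1\le i\le n}x_i(\mathcal{A}\mathbf{x}^{m-1})_i.$$ *)

(* Defs.v *)
From HB Require Import structures.
From mathcomp Require Import all_boot all_order all_algebra.
From mathcomp Require Import all_classical all_reals all_analysis.

Set Implicit Arguments.
Unset Strict Implicit.
Unset Printing Implicit Defensive.

Import Order.TTheory GRing.Theory Num.Theory.
Import numFieldNormedType.Exports.

Local Open Scope classical_set_scope.
Local Open Scope ring_scope.

(* [A t] is the entry a_{i_1 ... i_m} for t = (i_1, ..., i_m). *)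
Definition tensor (R : Type) (m n : nat) := {ffun m.-tuple 'I_n -> R}.

(* A x^{m-1}. Summing over the multi-indices (i_1, ..., i_m) with i_1 = i is
   summing over (i_2, ..., i_m); the monomial is x_{i_2} ... x_{i_m}. *)
Definition tensor_app (R : realType) (m n : nat) (A : tensor R m n)
    (x : 'cV[R]_n) : 'cV[R]_n :=
  \col_i \sum_(t : m.-tuple 'I_n | ohead t == Some i)
            A t * \prod_(j <- behead t) x j 0.

Definition nonneg_vec (R : realType) (n : nat) (x : 'cV[R]_n) : Prop :=
  forall i, 0 <= x i 0.

Definition pos_part (R : realType) (n : nat) (x : 'cV[R]_n) : 'cV[R]_n :=
  \col_i Num.max (x i 0) 0.

Definition strictly_semi_positive (R : realType) (m n : nat)
    (A : tensor R m n) : Prop :=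
  forall x : 'cV[R]_n, nonneg_vec x -> x != 0 ->
    exists k, 0 < x k 0 /\ 0 < tensor_app A x k 0.

Definition TCP_solution (R : realType) (m n : nat) (A : tensor R m n)
    (q x : 'cV[R]_n) : Prop :=
  [/\ nonneg_vec x,
      nonneg_vec (q + tensor_app A x) &
      x^T *m (q + tensor_app A x) = 0].

(* The least element of S; the value is 0 when S has none. *)
Definition minimum (R : realType) (S : set R) : R :=
  xget 0 [set b | S b /\ lbound S b].

(* The maximum is taken over the nonempty index set 'I_n.+1, so seeding it with
   the value at ord0 (rather than 0) does not alter it. *)
Definition max_hadamard (R : realType) (m n : nat) (A : tensor R m n.+1)
    (x : 'cV[R]_n.+1) : R :=
  let f i := x i 0 * tensor_app A x i 0 in
  \big[Num.max/f ord0]_(i < n.+1) f i.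

(* The library norm `|x| on matrices is the maximum of the absolute values of
   the entries, i.e. the infinity norm. *)
Definition beta (R : realType) (m n : nat) (A : tensor R m n.+1) : R :=
  minimum [set max_hadamard A x | x in
             [set x : 'cV[R]_n.+1 | nonneg_vec x /\ `|x| = 1]].

(* Main.v *)
Require Import Defs.
From HB Require Import structures.
From mathcomp Require Import all_boot all_order all_algebra.
From mathcomp Require Import all_classical all_reals all_analysis.

Set Implicit Arguments.
Unset Strict Implicit.
Unset Printing Implicit Defensive.

Import Order.TTheory GRing.Theory Num.Theory.
Import numFieldNormedType.Exports.

(** Write r = |x| for the infinity norm and h(y) = max_i y_i (A y^{m-1})_i.
    The bound comes from squeezing one product x_i (A x^{m-1})_i between two
    quantities.

    From below: A x^{m-1} is homogeneous of degree m - 1 in x, so h is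
    homogeneous of degree m on nonnegative vectors, and h(x / r) >= beta(A)
    gives an index i with beta(A) r^m <= x_i (A x^{m-1})_i
    ([beta_homogeneous_le]).

    From above: all terms of x^T (q + A x^{m-1}) = 0 are nonnegative, so each
    of them vanishes, and x_i (A x^{m-1})_i = - q_i x_i <= |(-q)_+| r
    ([TCP_complementary]).

    Dividing by r leaves beta(A) r^{m-1} <= |(-q)_+|.  To divide by beta(A) as
    well, it must be positive.  The function h is continuous and the nonnegative
    part of the unit sphere is compact and nonempty, so the minimum defining
    beta(A) is attained ([beta_attained]); at a minimizer c, strict
    semi-positivity yields an index k at which both factors of
    c_k (A c^{m-1})_k are positive ([beta_gt0]). *)

Local Open Scope ring_scope.

Lemma minimum_eq (R : realType) (S : set R) (b : R) :
  S b -> lbound S b -> minimum S = b.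
Proof.
move=> Sb lb; rewrite /minimum; case: xgetP => [c -> [Sc lc]|/(_ b)[]//].
by apply/eqP; rewrite eq_le lc ?lb.
Qed.

Lemma norm_bigmax (R : realType) (m n : nat) (x : 'M[R]_(m, n)) :
  `|x| = \big[Num.max/0]_ij `|x ij.1 ij.2|.
Proof. exact: mx_normrE. Qed.

(** Compactness is obtained for sets of row vectors, whereas tensors act on
    columns; this makes transposition match the two unit spheres. *)
Lemma normr_tr (R : realType) (m n : nat) (x : 'M[R]_(m, n)) : `|x^T| = `|x|.
Proof.
suff le p q (y : 'M[R]_(p, q)) : `|y^T| <= `|y|.
  by apply/eqP; rewrite eq_le le -[in leLHS](trmxK x) le.
rewrite [leLHS]norm_bigmax; apply/bigmax_leP; split=> // -[i j] _.
rewrite mxE /= [leRHS]norm_bigmax.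
by apply/bigmax_geP; right; exists (j, i).
Qed.

Lemma ler_entry_norm (R : realType) (m n : nat) (x : 'M[R]_(m, n)) i j :
  `|x i j| <= `|x|.
Proof.
rewrite [leRHS]norm_bigmax.
by apply/bigmax_geP; right; exists (i, j).
Qed.

(** Each monomial has one factor per index after the first, hence degree m - 1;
    at m = 0 the truncated exponent is 0, as is the length of the tail of the
    empty multi-index. *)
Lemma tensor_appZ (R : realType) (m n : nat) (A : tensor R m n) (c : R)
    (x : 'cV[R]_n) :
  tensor_app A (c *: x) = c ^+ (m - 1) *: tensor_app A x.
Proof.
apply/colP => i; rewrite !mxE big_distrr; apply: eq_bigr => t _ /=.
rewrite mulrCA; congr (_ * _).
under eq_bigr do rewrite mxE.
rewrite big_split /=; congr (_ * _).
by rewrite big_const_seq count_predT size_behead size_tuple subn1 -Monoid.iteropE.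
Qed.

Lemma max_hadamard_ge (R : realType) (m n : nat) (A : tensor R m n.+1)
    (x : 'cV[R]_n.+1) i : x i 0 * tensor_app A x i 0 <= max_hadamard A x.
Proof. by apply/bigmax_geP; right; exists i. Qed.

Lemma max_hadamard_attained (R : realType) (m n : nat) (A : tensor R m n.+1)
    (x : 'cV[R]_n.+1) :
  exists i, max_hadamard A x = x i 0 * tensor_app A x i 0.
Proof.
rewrite /max_hadamard; elim/big_ind: _ => [|a b [i ->] [j ->]|i _].
- by exists ord0.
- by case: leP => _; [exists j|exists i].
- by exists i.
Qed.

(** The seed is allowed to vary with the point because [max_hadamard] starts
    from the entry at index 0 instead of a constant. *)
Lemma continuous_bigmax (R : realType) (T : topologicalType) (I : Type)
    (r : seq I) (f0 : T -> R) (F : I -> T -> R) :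
  continuous f0 -> (forall i, continuous (F i)) ->
  continuous (fun x => \big[Num.max/f0 x]_(i <- r) F i x).
Proof.
move=> f0_cont F_cont; elim: r => [|i r IHr].
  by under eq_fun do rewrite big_nil.
under eq_fun do rewrite big_cons.
by apply: max_fun_continuous.
Qed.

Lemma coord_tr_continuous (R : realType) (m n : nat) i j :
  continuous (fun M : 'M[R]_(m, n) => M^T i j).
Proof. under eq_fun do rewrite mxE; exact: coord_continuous. Qed.

Lemma tensor_app_tr_continuous (R : realType) (m n : nat) (A : tensor R m n)
    i : continuous (fun v : 'rV[R]_n => tensor_app A v^T i 0).
Proof.
under eq_fun do rewrite mxE.
apply: continuous_big => [|t _]; first exact: add_continuous.
move=> v; apply: continuousM; first exact: cst_continuous.
move: v; apply: continuous_big => [|j _]; first exact: mul_continuous.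
exact: coord_tr_continuous.
Qed.

Lemma max_hadamard_tr_continuous (R : realType) (m n : nat)
    (A : tensor R m n.+1) :
  continuous (fun v : 'rV[R]_n.+1 => max_hadamard A v^T).
Proof.
have f_cont i : continuous
    (fun v : 'rV[R]_n.+1 => v^T i 0 * tensor_app A v^T i 0).
  move=> v; apply: continuousM; last exact: tensor_app_tr_continuous.
  exact: coord_tr_continuous.
exact: continuous_bigmax.
Qed.

(** Heine-Borel: the set lies in the unit ball, and it is the intersection of
    preimages of closed sets under the coordinates and the norm. *)
Lemma nonneg_unit_rV_compact (R : realType) (n : nat) :
  compact [set v : 'rV[R]_n | (forall i, 0 <= v 0 i) /\ `|v| = 1].
Proof.
apply: bounded_closed_compact.
  by exists 1; split=> // M M1 v [_ v1] /=; rewrite v1 ltW.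
rewrite [X in closed X](_ : _ =
    (\bigcap_(i in setT) [set v : 'rV[R]_n | 0 <= v 0 i]) `&`
    [set v : 'rV[R]_n | `|v| = 1])%classic; last first.
  by apply/seteqP; split=> v /= [v_ge0 v1]; split=> // i *; exact: v_ge0.
apply: closedI.
  apply: closed_bigI => i _.
  apply: (@preimage_closed _ _ (fun v : 'rV[R]_n => v 0 i) [set y | 0 <= y]).
    by move=> v _; exact: coord_continuous.
  exact: closed_ge.
apply: (@preimage_closed _ _ (fun v : 'rV[R]_n => `|v|) [set y | y = 1]).
  by move=> v _; exact: norm_continuous.
exact: closed_eq.
Qed.

(** Extreme value theorem, applied to v |-> [max_hadamard A v^T] on row vectors
    and transposed back. Without a minimizer [beta A] would be the default value
    0, so this is what gives [beta A] its meaning. *)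
Lemma beta_attained (R : realType) (m n : nat) (A : tensor R m n.+1) :
  exists2 c : 'cV[R]_n.+1, nonneg_vec c /\ `|c| = 1 &
    beta A = max_hadamard A c /\
    forall y, nonneg_vec y -> `|y| = 1 -> max_hadamard A c <= max_hadamard A y.
Proof.
pose K := [set v : 'rV[R]_n.+1 | (forall i, 0 <= v 0 i) /\ `|v| = 1]%classic.
have K0 : (K !=set0)%classic.
  (* The all-ones vector has norm 1 because there is at least one index. *)
  exists (const_mx 1); split=> [i|]; first by rewrite mxE.
  apply/eqP; rewrite eq_le; apply/andP; split.
    rewrite [leLHS]norm_bigmax; apply/bigmax_leP; split=> // i _.
    by rewrite mxE normr1.
  by have := ler_entry_norm (const_mx 1 : 'rV[R]_n.+1) 0 0; rewrite mxE normr1.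
have [c /set_mem[c_ge0 c1] minc] := compact_EVT_min K0
  (@nonneg_unit_rV_compact R n.+1)
  (continuous_subspaceT (@max_hadamard_tr_continuous R m n A)).
have le_c y : nonneg_vec y -> `|y| = 1 ->
    max_hadamard A c^T <= max_hadamard A y.
  move=> y_ge0 y1; rewrite -(trmxK y); apply/minc/mem_set.
  by split=> [i|]; rewrite ?mxE // normr_tr.
have cT : nonneg_vec c^T /\ `|c^T| = 1.
  by split=> [i|]; rewrite ?mxE // normr_tr.
exists c^T => //; split=> //.
apply: minimum_eq; first by exists c^T.
by move=> _ [y [y_ge0 y1] <-]; exact: le_c.
Qed.

Lemma beta_le (R : realType) (m n : nat) (A : tensor R m n.+1)
    (y : 'cV[R]_n.+1) :
  nonneg_vec y -> `|y| = 1 -> beta A <= max_hadamard A y.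
Proof. by move=> y0 y1; have [c _ [-> le_c]] := beta_attained A; exact: le_c. Qed.

(** The index given by strict semi-positivity at a minimizer makes one of the
    products under the maximum positive. *)
Lemma beta_gt0 (R : realType) (m n : nat) (A : tensor R m n.+1) :
  strictly_semi_positive A -> 0 < beta A.
Proof.
move=> hA; have [c [c_ge0 c1] [-> _]] := beta_attained A.
have c_neq0 : c != 0 by rewrite -normr_eq0 c1 oner_eq0.
have [k [ck Ack]] := hA c c_ge0 c_neq0.
by apply: lt_le_trans (max_hadamard_ge A c k); exact: mulr_gt0.
Qed.

(** Definition of [beta] at the normalized vector x / |x|, rescaled by |x|^m;
    the factor |x| comes from x_i and |x|^(m-1) from A x^(m-1). *)
Lemma beta_homogeneous_le (R : realType) (m n : nat) (A : tensor R m n.+1)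
    (x : 'cV[R]_n.+1) :
  nonneg_vec x -> x != 0 ->
  exists i, beta A * `|x| * `|x| ^+ (m - 1) <= x i 0 * tensor_app A x i 0.
Proof.
move=> x_ge0 x_neq0; have r_gt0 : 0 < `|x| by rewrite normr_gt0.
pose y := `|x|^-1 *: x.
have y_ge0 : nonneg_vec y by move=> i; rewrite mxE mulr_ge0 ?invr_ge0.
have y1 : `|y| = 1.
  by rewrite mx_normZ normfV normr_id mulVf // gt_eqF.
have xE : x = `|x| *: y by rewrite scalerA divff ?scale1r // gt_eqF.
have [i yi] := max_hadamard_attained A y.
exists i; rewrite [in leRHS]xE tensor_appZ [(_ *: y) i 0]mxE.
rewrite [(_ *: tensor_app A y) i 0]mxE.
rewrite mulrACA -mulrA [leLHS]mulrC ler_pM2l ?mulr_gt0 ?exprn_gt0 //.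
by rewrite -yi; exact: beta_le.
Qed.

(** A sum of nonnegative terms x_j (q + A x^(m-1))_j that is zero has all its
    terms zero. *)
Lemma TCP_complementary (R : realType) (m n : nat) (A : tensor R m n)
    (q x : 'cV[R]_n) i :
  TCP_solution A q x -> x i 0 * tensor_app A x i 0 = - q i 0 * x i 0.
Proof.
move=> [x_ge0 s_ge0 /matrixP/(_ 0 0)]; rewrite mxE [RHS]mxE => /eqP.
rewrite psumr_eq0 => [|j _]; last by rewrite mxE mulr_ge0.
move=> /allP/(_ i); rewrite mem_index_enum => /(_ isT) /eqP.
rewrite !mxE mulrDr => /eqP; rewrite addrC addr_eq0 => /eqP ->.
by rewrite mulrC mulNr.
Qed.

(* The dimension is n.+1, so n ranges over all dimensions >= 1. *)
Theorem theorem3p8 (R : realType) (m n : nat) (hm : (2 <= m)%N)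
    (A : tensor R m n.+1) (hA : strictly_semi_positive A)
    (q x : 'cV[R]_n.+1) (hx : TCP_solution A q x) :
  `|x| ^+ (m - 1) <= `|pos_part (- q)| / beta A.
Proof.
have b_gt0 := beta_gt0 hA; have [x_ge0 _ _] := hx.
have [->|x_neq0] := eqVneq x 0.
  rewrite normr0 expr0n subn_eq0 leqNgt hm /=.
  by rewrite divr_ge0 // ltW.
have r_gt0 : 0 < `|x| by rewrite normr_gt0.
have [i] := beta_homogeneous_le A x_ge0 x_neq0.
rewrite (TCP_complementary i hx) => le_i.
rewrite ler_pdivlMr // -(ler_pM2r r_gt0).
apply: le_trans (_ : - q i 0 * x i 0 <= _).
  by rewrite -[leLHS]mulrA [leLHS]mulrC.
have qi_le : - q i 0 <= `|pos_part (- q)|.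
  apply: le_trans (ler_entry_norm _ i 0); apply: le_trans (ler_norm _).
  by rewrite !mxE le_max lexx.
apply: le_trans (ler_wpM2r (x_ge0 i) qi_le) _.
by apply: ler_wpM2l => //; exact: le_trans (ler_norm _) (ler_entry_norm _ i 0).
Qed.
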